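(* Let $\eta > 0$, $\nu < \eta$, $\rho \in (0,1]$, and let $X$ and $(Y^n)_{n\ge0}$ be as defined in the context. Let $t > 0$ and $x \in [\nu,\eta]$. Then the sequence $\left(\mathbb{P}(X_t - Y^n_t \ge x)\right)_{n\ge0}$ is increasing in $n$, in the sense that $\mathbb{P}(X_t - Y^{n}_t \ge x) \le \mathbb{P}(X_t - Y^{n+1}_t \ge x)$ for all $n \ge 0$.
   Context: $B^X$ and $B^Y$ are independent standard Brownian motions (started at $0$) with respect to a filtration $(\mathcal{F}_t)_{t\ge0}$ on a filtered probability space $(\Omega,\mathcal{F},(\mathcal{F}_t)_{t\ge0},\mathbb{P})$ satisfying the usual conditions; $X$ denotes $B^X$. Set $\alpha_0 = 0$, $\alpha_k = \eta$ if $k$ is odd, and $\alpha_k = \nu$ if $k$ is even and $k \ne 0$. For a Brownian motion $B$ and a stopping time $\tau$, $\mathcal{R}(B,\tau)$ denotes the reflection of $B$ at time $\tau$: $\mathcal{R}(B,\tau)_t = B_t - 2(B_t - B_\tau)\mathbf{1}_{t \ge \tau}$ (that is, $B_t$ for $t<\tau$ and $2B_\tau - B_t$ for $t \ge \tau$). Define recursively $\tau_0 = 0$, $\tilde{B}^0 = -B^X$, $Y^0 = \rho\tilde{B}^0 + \sqrt{1-\rho^2}\,B^Y$, and for $k \ge 1$ $$\tau_k = \inf\{t \ge \tau_{k-1} : B^X_t - Y^{k-1}_t = \alpha_k\},\quad \tilde{B}^k = \mathcal{R}(\tilde{B}^{k-1},\tau_k),\quad Y^k = \rho\tilde{B}^k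 + \sqrt{1-\rho^2}\,B^Y,$$ with $\inf\emptyset = +\infty$. *)

(* Defs.v *)
From HB Require Import structures.
From mathcomp Require Import all_boot all_order all_algebra.
From mathcomp Require Import all_classical all_reals all_analysis.

Set Implicit Arguments.
Unset Strict Implicit.
Unset Printing Implicit Defensive.

Import Order.TTheory GRing.Theory Num.Theory.
Import numFieldNormedType.Exports.

Local Open Scope classical_set_scope.
Local Open Scope ring_scope.

(* The time set is [0, +oo[: families indexed by time are functions on all of
   R, and nothing is assumed about their values at negative times. *)

Section stochastic_processes.
Context (d : measure_display) (Omega : measurableType d) (R : realType).
Variable P : probability Omega R.

Definition independent (G H : set_system Omega) : Prop :=
  forall A B, G A -> H B -> P (A `&` B) = (P A * P B)%E.

Definition sigma_rv (Z : Omega -> R) : set_system Omega :=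
  preimage_set_system setT Z measurable.

Definition sigma_process (B : R -> Omega -> R) : set_system Omega :=
  <<s \bigcup_(t in [set t | 0 <= t]) sigma_rv (B t) >>.

Record filtration (F : R -> set_system Omega) : Prop := {
  filtration_sigma_algebra : forall t : R, 0 <= t -> sigma_algebra setT (F t) ;
  filtration_measurable : forall t : R, 0 <= t -> F t `<=` measurable ;
  filtration_le : forall s t : R, 0 <= s -> s <= t -> F s `<=` F t }.

Record usual_conditions (F : R -> set_system Omega) : Prop := {
  usual_complete : measure_is_complete P ;
  usual_negligible : P.-negligible `<=` F 0 ;
  usual_right_continuous : forall s : R, 0 <= s ->
    \bigcap_(t in [set t | s < t]) F t = F s }.

(* The second argument of normal_prob is the standard deviation: increments
   over [s, t] have variance t - s. *)
Record brownian_motion (F : R -> set_system Omega) (B : R -> Omega -> R) :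
    Prop := {
  bm_adapted : forall t : R, 0 <= t -> sigma_rv (B t) `<=` F t ;
  bm_start : {ae P, forall w, B 0 w = 0} ;
  bm_continuous : {ae P, forall w, {within `[0, +oo[, continuous (B ^~ w)}} ;
  bm_independent_increments : forall s t : R, 0 <= s -> s < t ->
    independent (F s) (sigma_rv (B t \- B s)) ;
  bm_normal_increments : forall s t : R, 0 <= s -> s < t ->
    forall U : set R, measurable U ->
    P ((B t \- B s) @^-1` U) = normal_prob 0 (Num.sqrt (t - s)) U }.

End stochastic_processes.

Section mirror_couplings.
Context (Omega : Type) (R : realType).
Implicit Types (B Z : R -> Omega -> R) (tau sigma : Omega -> \bar R).

Definition reflection B tau (t : R) (w : Omega) : R :=
  if (tau w <= t%:E)%E then 2 * B (fine (tau w)) w - B t w else B t w.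

(* The infimum of the empty set is +oo; in particular the hitting time is +oo
   when sigma w = +oo. *)
Definition hitting_time Z (a : R) sigma (w : Omega) : \bar R :=
  ereal_inf [set t%:E | t in [set t : R | (sigma w <= t%:E)%E /\ Z t w = a]].

Definition level (eta nu : R) (k : nat) : R :=
  if k == 0%N then 0 else if odd k then eta else nu.

Definition correlate (rho : R) (B BY : R -> Omega -> R) (t : R) (w : Omega) : R :=
  rho * B t w + Num.sqrt (1 - rho ^+ 2) * BY t w.

(* The pair of the k-th switching time and the k-th reflected motion. *)
Fixpoint switching (eta nu rho : R) (BX BY : R -> Omega -> R) (k : nat) :
    (Omega -> \bar R) * (R -> Omega -> R) :=
  if k is k'.+1 then
    let: (tau, B) := switching eta nu rho BX BY k' in
    let tau' := hitting_time (fun t w => BX t w - correlate rho B BY t w)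
                  (level eta nu k) tau in
    (tau', reflection B tau')
  else (fun=> 0%E, fun t w => - BX t w).

Definition Y (eta nu rho : R) (BX BY : R -> Omega -> R) (k : nat) : R -> Omega -> R :=
  correlate rho (switching eta nu rho BX BY k).2 BY.

End mirror_couplings.

(* Main.v *)
(* Let Z^n = X - Y^n. The processes Z^n and Z^(n+1) agree up to tau = tau_(n+1),
   where both equal eta (n even) or nu (n odd). Writing DX, DY for the increments
   of B^X, B^Y over [tau, t] and s = sqrt (1 - rho^2), on {tau <= t} one of them
   moves by U = (1 + rho) DX - s DY and the other one by V = (1 - rho) DX - s DY.
   Conditionally on the past of tau, the pairs (DX, DY) and (-DY, -DX) have the
   same law; this substitution turns U into W = s DX - (1 + rho) DY, and
   V = (s / (1 + rho)) W with s / (1 + rho) in [0, 1[. Hence V is distributed as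
   a contraction of U, and P(tau <= t, V >= y) - P(tau <= t, U >= y) is
   nonnegative for y = x - eta <= 0 and nonpositive for y = x - nu >= 0 (if
   rho < 1; for rho = 1 the process is frozen at eta after tau_1). The strong
   Markov property behind this is obtained by discretising tau from above. *)
Require Import Defs.
From mathcomp Require Import all_boot all_order all_algebra.
From mathcomp Require Import all_classical all_reals all_analysis.
From mathcomp Require Import measurable_realfun ring lra.

Set Implicit Arguments.
Unset Strict Implicit.
Unset Printing Implicit Defensive.

Import Order.TTheory GRing.Theory Num.Theory.
Import numFieldNormedType.Exports.

Local Open Scope classical_set_scope.
Local Open Scope ring_scope.

(** * Hitting times and reflections of continuous paths *)

Section hitting_times.
Context (Omega : Type) (R : realType).
Implicit Types (Z B : R -> Omega -> R) (sigma tau : Omega -> \bar R) (w : Omega).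

Lemma hitting_time_ge Z a sigma w : (sigma w <= hitting_time Z a sigma w)%E.
Proof. by apply: le_ereal_inf_tmp => _ [u [su _] <-]. Qed.

(** If [Z u w] differed from [a], continuity would keep the path off [a] on a ball of radius [e]
    around [u], while the infimum leaves a visit to [a] in [[u, u + e[]. *)
Lemma hitting_time_eq Z a sigma w (u : R) :
  continuous (Z ^~ w) -> hitting_time Z a sigma w = u%:E -> Z u w = a.
Proof.
move=> cZ hu; apply/eqP/negPn/negP => Zua.
have /cvgrPdist_lt/(_ `|Z u w - a|) := cZ u.
rewrite normr_gt0 subr_eq0 => /(_ Zua) /nbhs_ballP[e /= e0 eZ].
have : (hitting_time Z a sigma w < (u + e)%:E)%E by rewrite hu lte_fin ltrDl.
move=> /ereal_inf_lt[_ [v [sv Zv] <-]]; rewrite lte_fin => vue.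
have uv : u <= v.
  rewrite -lee_fin -hu; apply: ereal_inf_lbound.
  by exists v.
suff /eZ : ball u e v by rewrite /= Zv ltxx.
by rewrite /ball/= ler0_norm ?subr_le0// opprB ltrBlDl.
Qed.

(** The infimum is attained because the path is continuous; [0 <= sigma w] excludes the value
    [-oo]. *)
Lemma hitting_time_le Z a sigma w (u : R) :
  (0 <= sigma w)%E -> continuous (Z ^~ w) ->
  (hitting_time Z a sigma w <= u%:E)%E <->
  exists2 v : R, v <= u & (sigma w <= v%:E)%E /\ Z v w = a.
Proof.
move=> s0 cZ; split=> [|[v vu sv]]; last first.
  by apply: (@le_trans _ _ v%:E); rewrite ?lee_fin//; apply: ereal_inf_lbound; exists v.
have := hitting_time_ge Z a sigma w.
have := hitting_time_eq cZ (a := a) (sigma := sigma).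
case: (hitting_time _ _ _ _) => [v /(_ v erefl)Zv sv vu||_ s] //.
- by exists v.
- by move: (le_trans s0 s).
Qed.

(** With [Num.max u v] the reflected path is a single formula in [u], so its continuity follows by
    composition. *)
Lemma reflection_stopped B tau w (u v : R) : tau w = v%:E ->
  reflection B tau u w = B u w - 2 * (B (Num.max u v) w - B v w).
Proof.
rewrite /reflection => ->; rewrite lee_fin /=.
by case: leP => uv; ring.
Qed.

Lemma continuous_reflection B tau w : (0 <= tau w)%E ->
  continuous (B ^~ w) -> continuous (reflection B tau ^~ w).
Proof.
case tauw : (tau w) => [v||]// _ cB.
- rewrite (_ : reflection _ _ ^~ _ =
    fun u => B u w - 2 * (B (Num.max u v) w - B v w)); last first.
    by apply/funext => u; exact: reflection_stopped.
  move=> u; apply: cvgB; first exact: cB.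
  apply: cvgMr; apply: cvgB; last exact: cvg_cst.
  apply: (continuous_comp (f := fun u => Num.max u v) (g := B ^~ w)); last exact: cB.
  by apply: continuous_max; [exact: cvg_id|exact: cvg_cst].
- rewrite (_ : reflection _ _ ^~ _ = B ^~ w)//.
  by apply/funext => u; rewrite /reflection tauw.
Qed.

End hitting_times.

(** * Stopping times and adapted processes *)

Section adapted_processes.
Context (Omega : pointedType) (R : realType).
Implicit Types (Z B : R -> Omega -> R) (sigma tau : Omega -> \bar R).
Variable G : R -> set_system Omega.
Hypothesis Gle : forall s u : R, 0 <= s -> s <= u -> G s `<=` G u.

(** [G u] is only a generating family, so that it can later be a pi-system; adaptedness refers to
    the sigma-algebra it generates. *)
Definition adapted Z := forall u : R, 0 <= u ->
  measurable_fun [set: g_sigma_algebraType (G u)] (Z u).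

Definition stopping_time tau := forall u : R, 0 <= u ->
  <<s G u >> [set w | (tau w <= u%:E)%E].

Lemma sigma_filtration_le (s u : R) : 0 <= s -> s <= u ->
  <<s G s >> `<=` <<s G u >>.
Proof. by move=> s0 su; apply: sub_sigma_algebra2; exact: Gle. Qed.

Lemma adapted_le Z (s u : R) : adapted Z -> 0 <= s -> s <= u ->
  measurable_fun [set: g_sigma_algebraType (G u)] (Z s).
Proof.
move=> aZ s0 su _ C mC; apply: (sigma_filtration_le s0 su).
exact: aZ.
Qed.

Lemma adapted_preimage Z (u : R) C : adapted Z -> 0 <= u -> measurable C ->
  <<s G u >> (Z u @^-1` C).
Proof. by move=> aZ u0 mC; rewrite -[_ @^-1` _]setTI; exact: aZ. Qed.

(** Reduces the event to countably many conditions. A visit to [a] strictly before [u] is detected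
    by rationals just after it; a visit at [u] itself may leave no rational between [sigma w] and
    [u], hence the separate clause. *)
Lemma hitting_time_le_rat Z a sigma w (u : R) :
  (0 <= sigma w)%E -> continuous (Z ^~ w) -> 0 <= u ->
  (hitting_time Z a sigma w <= u%:E)%E <->
  (sigma w <= u%:E)%E /\ (Z u w = a \/
   forall j : nat, exists q : rat, [/\ 0 <= ratr q :> R, ratr q <= u,
     (sigma w <= (ratr q)%:E)%E & `|Z (ratr q) w - a| < j.+1%:R^-1]).
Proof.
move=> s0 cZ u0; rewrite hitting_time_le//; split=> [[v vu [sv Zva]]|].
  split; first by apply: le_trans sv _; rewrite lee_fin.
  move: vu; rewrite le_eqVlt => /predU1P[<-|vu]; [by left|right=> j].
  have /cvgrPdist_lt/(_ j.+1%:R^-1) := cZ v.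
  rewrite invr_gt0 ltr0n => /(_ isT)/nbhs_ballP[e /= e0 eZ].
  have [q] : exists q, ratr q \in `]v, Num.min u (v + e)[.
    by apply: rat_in_itvoo; rewrite lt_min vu ltrDl.
  rewrite in_itv/= lt_min => /and3P[vq qu qe].
  have v0 : 0 <= v by rewrite -lee_fin (le_trans s0).
  exists q; split; [exact: le_trans v0 (ltW vq)|exact: ltW| |].
    by apply: le_trans sv _; rewrite lee_fin ltW.
  rewrite -Zva distrC; apply: eZ.
  by rewrite /ball/= ltr0_norm ?subr_lt0// opprB ltrBlDl.
move=> [su [Zua|H]]; first by exists u.
case: (sigma w) s0 su H => [s||]//; rewrite !lee_fin => s0 su H.
(* Conversely, the distance to [a] attains its minimum on the compact interval [[s, u]], and the
   rational points force this minimum below every [j.+1%:R^-1]. *)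
have /(EVT_min su)[c] : {within `[s, u], continuous (fun v => `|Z v w - a|)}.
  apply: continuous_subspaceT => v; apply: cvg_norm.
  by apply: cvgB; [exact: cZ|exact: cvg_cst].
rewrite in_itv/= => /andP[sc cu] cmin.
exists c => //; split; first by rewrite lee_fin.
apply/eqP; rewrite -subr_eq0 -normr_eq0 -[_ == 0]negbK -normr_gt0 normr_id.
apply/negP => Zc0.
have [j] := ltr_add_invr Zc0; rewrite add0r => jZ.
have [q [_ qu + qj]] := H j; rewrite lee_fin => sq.
have := cmin (ratr q); rewrite in_itv/= sq qu => /(_ isT).
by rewrite leNgt (lt_trans qj).
Qed.

Lemma stopping_time_hitting_time Z a sigma :
  (forall w, 0 <= sigma w)%E -> (forall w, continuous (Z ^~ w)) ->
  adapted Z -> stopping_time sigma -> stopping_time (hitting_time Z a sigma).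
Proof.
move=> s0 cZ aZ ss u u0.
(* Empty for rationals outside [[0, u]], so that the union can run over all of [rat]. *)
pose S j (q : rat) : set (g_sigma_algebraType (G u)) :=
  if (0 <= ratr q :> R) && (ratr q <= u) then
    [set w | (sigma w <= (ratr q)%:E)%E] `&`
    (fun w => `|Z (ratr q) w - a|) @^-1` [set` `]-oo, j.+1%:R^-1[ ]
  else set0.
rewrite (_ : [set w | _] = [set w | (sigma w <= u%:E)%E] `&`
    (Z u @^-1` [set a] `|` \bigcap_j \bigcup_q S j q)); last first.
  apply/seteqP; split=> w /=.
    move=> /(hitting_time_le_rat _ (s0 w) (cZ w) u0)[su H]; split => //.
    case: H => [Za|H]; [by left|right=> j _].
    have [q [q0 qu sq Zq]] := H j.
    by exists q => //; rewrite /S q0 qu/=; split => //=; rewrite in_itv.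
  move=> [su H]; apply/(hitting_time_le_rat _ (s0 w) (cZ w) u0); split => //.
  case: H => [Za|H]; [by left|right=> j].
  have [q _] := H j I; rewrite /S; case: ifPn => // /andP[q0 qu] [sq].
  by rewrite /= in_itv => Zq; exists q.
apply: (@measurableI _ (g_sigma_algebraType (G u))); first exact: ss.
apply: (@measurableU _ (g_sigma_algebraType (G u))).
  exact: adapted_preimage.
apply: bigcapT_measurable => j; apply: bigcupT_measurable_rat => q.
rewrite /S; case: ifPn => // /andP[q0 qu].
apply: measurableI.
  by apply: (sigma_filtration_le q0 qu); exact: ss.
have mZ : measurable_fun [set: g_sigma_algebraType (G u)]
    (fun w => `|Z (ratr q) w - a|).
  by apply: measurableT_comp => //; apply: measurable_funB => //; exact: adapted_le.
by rewrite -[X in measurable X]setTI; exact: mZ.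
Qed.


(** * Discretisation of a stopping time on a grid *)

Definition grid (t : R) (m k : nat) : R := t * (k%:R / m.+1%:R).

(* The first grid point after [tau]; it does not exceed [t] when [tau <= t]. *)
Definition grid_index t m tau (w : Omega) : nat :=
  find (fun k => (tau w <= (grid t m k)%:E)%E) (iota 0 m.+2).

Lemma grid_ge0 t m k : 0 <= t -> 0 <= grid t m k.
Proof. by move=> t0; rewrite /grid mulr_ge0// divr_ge0. Qed.

Lemma le_grid t m j k : 0 <= t -> (j <= k)%N -> grid t m j <= grid t m k.
Proof.
by move=> t0 jk; rewrite /grid ler_wpM2l// ler_pM2r ?ler_nat// invr_gt0 ltr0n.
Qed.

Lemma grid_max t m : grid t m m.+1 = t.
Proof. by rewrite /grid divff ?mulr1// pnatr_eq0. Qed.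

Lemma grid_le t m k : 0 <= t -> (k <= m.+1)%N -> grid t m k <= t.
Proof. by move=> t0 km; rewrite -[leRHS](grid_max t m); exact: le_grid. Qed.

(** The condition tested by [find] is monotone in the index, so the first success comes at or before
    [k] exactly when [k] succeeds. *)
Lemma grid_index_le t m tau w k : 0 <= t -> (k <= m.+1)%N ->
  (grid_index t m tau w <= k)%N = (tau w <= (grid t m k)%:E)%E.
Proof.
move=> t0 km; set a := fun k => (tau w <= (grid t m k)%:E)%E.
have amono i j : (i <= j)%N -> a i -> a j.
  by move=> ij /le_trans; apply; rewrite lee_fin le_grid.
rewrite -/(a k); apply/idP/idP => [ik|ak].
  apply: (amono _ _ ik); have := @nth_find _ 0%N a (iota 0 m.+2).
  rewrite has_find size_iota; have im := leq_ltn_trans (leq_trans ik km) (ltnSn _).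
  by rewrite nth_iota// => /(_ im).
rewrite leqNgt; apply/negP => /(before_find 0%N).
by rewrite nth_iota ?ltnS ?(leq_trans km)// add0n -/(a k) ak.
Qed.

(** If [tau w] exceeds [t], the search fails and [find] returns [m.+2], the length of the list. *)
Lemma grid_index_max t m tau w : 0 <= t ->
  (grid_index t m tau w <= m.+1)%N = (tau w <= t%:E)%E.
Proof. by move=> t0; rewrite grid_index_le// grid_max. Qed.

Lemma grid_index_cvg t tau w (v : R) : 0 <= t -> 0 <= v <= t -> tau w = v%:E ->
  grid t m (grid_index t m tau w) @[m --> \oo] --> v.
Proof.
move=> t0 /andP[v0 vt] tauw.
have tc : v + t * m.+1%:R^-1 @[m --> \oo] --> v.
  rewrite -[X in _ --> X]addr0 -(mulr0 t); apply: cvgD; first exact: cvg_cst.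
  by apply: cvgMr; exact: cvg_harmonic.
apply: (squeeze_cvgr _ (cvg_cst v) tc).
near=> m.
have im : (grid_index t m tau w <= m.+1)%N by rewrite grid_index_max// tauw lee_fin.
have := leqnn (grid_index t m tau w).
rewrite grid_index_le// tauw lee_fin => ->/=.
(* For the upper bound, index [0] is the grid point [0]; at index [k.+1], minimality puts the point
   of index [k] before [v], and the mesh is [t / m.+1]. *)
case: (grid_index _ _ _ _) (@grid_index_le t m tau w) im => [|k] H km.
  by rewrite /grid mul0r mulr0 addr_ge0// mulr_ge0.
have := H k t0 (ltnW km); rewrite ltnn tauw lee_fin => /esym/negbT.
rewrite -ltNge => kv.
rewrite /grid -natr1 mulrDl mulrDr mul1r lerD2r; exact: ltW.
Unshelve. all: by end_near. Qed.

(** On this event the discretised time has a single value, and the event belongs to the past of that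
    value; this lets an identity at fixed times be applied piece by piece. *)
Lemma grid_index_eq t m tau k : 0 <= t -> (k <= m.+1)%N -> stopping_time tau ->
  <<s G (grid t m k) >>
    [set w | (tau w <= t%:E)%E /\ grid_index t m tau w = k].
Proof.
move=> t0 km st.
have st' j : (j <= k)%N ->
    <<s G (grid t m k) >> [set w | (grid_index t m tau w <= j)%N].
  move=> jk; rewrite (_ : [set w | _] = [set w | (tau w <= (grid t m j)%:E)%E]).
    by apply: (@sigma_filtration_le (grid t m j)); rewrite ?grid_ge0 ?le_grid//;
      apply: st; exact: grid_ge0.
  by apply/seteqP; split=> w /=; rewrite grid_index_le// (leq_trans jk).
rewrite (_ : [set w | _ /\ _] = [set w | (grid_index t m tau w <= k)%N] `\`
   (if k is k'.+1 then [set w | (grid_index t m tau w <= k')%N] else set0)).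
  apply: (@measurableD _ (g_sigma_algebraType (G (grid t m k)))).
    exact: st'.
  by case: k {km} st' => // k st'; apply: st'.
apply/seteqP; split=> w /=; rewrite -(@grid_index_max t m)//.
  by move=> [_ <-]; split=> //; case idx: (grid_index _ _ _ _) => [|k'] //=; rewrite idx ltnn.
move=> [ik Hk]; split; first exact: leq_trans ik km.
apply/eqP; rewrite eqn_leq ik /=; case: k Hk {ik km st'} => //= k /negP.
by rewrite -ltnNge.
Qed.

(** The value [0] when [tau w] exceeds [t] is a default that keeps the variable measurable at time
    [t]. *)
Definition stopped_value t tau Z (w : Omega) : R :=
  if (tau w <= t%:E)%E then Z (fine (tau w)) w else 0.

(** A finite sum over the values of the grid index, so that measurability at time [t] can be read
    off term by term. *)
Definition grid_value t m tau Z (w : Omega) : R :=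
  \sum_(k < m.+2) \1_[set w | (tau w <= t%:E)%E /\ grid_index t m tau w = k] w *
    Z (grid t m k) w.

Lemma grid_valueE t m tau Z w : 0 <= t -> (tau w <= t%:E)%E ->
  grid_value t m tau Z w = Z (grid t m (grid_index t m tau w)) w.
Proof.
move=> t0 tw.
have im : (grid_index t m tau w < m.+2)%N by rewrite ltnS grid_index_max.
rewrite /grid_value (bigD1 (Ordinal im))//= indicE mem_set ?mul1r//.
rewrite big1 ?addr0// => k /eqP kD; rewrite indicE memNset ?mul0r// => -[_ /= ki].
by apply: kD; exact/val_inj.
Qed.

Lemma grid_value_cvg t tau Z w : 0 <= t -> (0 <= tau w)%E ->
  continuous (Z ^~ w) ->
  grid_value t m tau Z w @[m --> \oo] --> stopped_value t tau Z w.
Proof.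
move=> t0 tau0 cZ; rewrite /stopped_value.
have [tw|tw] := leP (tau w) t%:E; last first.
  rewrite (_ : (fun m => _) = cst 0); first exact: cvg_cst.
  apply/funext => m; rewrite /grid_value big1// => k _.
  by rewrite indicE memNset ?mul0r// => -[/=]; rewrite leNgt tw.
under eq_fun do rewrite grid_valueE//.
case tauw: (tau w) tau0 tw => [v||]//; rewrite !lee_fin => v0 vt /=.
by apply: (cvg_comp _ (Z ^~ w) (grid_index_cvg t0 _ tauw)); rewrite ?v0//; exact: cZ.
Qed.

Lemma measurable_grid_value t m tau Z : 0 <= t -> adapted Z -> stopping_time tau ->
  measurable_fun [set: g_sigma_algebraType (G t)] (grid_value t m tau Z).
Proof.
move=> t0 aZ st; apply: measurable_sum => k.
have km : (k <= m.+1)%N by rewrite -ltnS.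
apply: measurable_funM; last first.
  by apply: adapted_le => //; [exact: grid_ge0|exact: grid_le].
apply: measurable_indic.
by apply: (@sigma_filtration_le (grid t m k)); rewrite ?grid_ge0 ?grid_le//;
  exact: grid_index_eq.
Qed.

Lemma measurable_stopped_value t tau Z : 0 <= t -> (forall w, 0 <= tau w)%E ->
  (forall w, continuous (Z ^~ w)) -> adapted Z -> stopping_time tau ->
  measurable_fun [set: g_sigma_algebraType (G t)] (stopped_value t tau Z).
Proof.
move=> t0 tau0 cZ aZ st.
apply: (@measurable_fun_cvg _ (g_sigma_algebraType (G t)) R setT
  (fun m => grid_value t m tau Z)) => [m|w _]; first exact: measurable_grid_value.
exact: grid_value_cvg.
Qed.

(** * Adaptedness of reflections and of the switching construction *)

Lemma adapted_reflection B tau : (forall w, 0 <= tau w)%E ->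
  (forall w, continuous (B ^~ w)) -> adapted B -> stopping_time tau ->
  adapted (reflection B tau).
Proof.
move=> tau0 cB aB st u u0.
rewrite (_ : reflection B tau u = fun w => if (tau w <= u%:E)%E then
    2 * stopped_value u tau B w - B u w
  else B u w); last by
  apply/funext => w; rewrite /reflection /stopped_value; case: ifP.
apply: measurable_fun_ifT; last exact: aB.
  by apply: (measurable_fun_bool true); rewrite setTI; exact: st.
apply: measurable_funB; last exact: aB.
by apply: measurable_funM => //; exact: measurable_stopped_value.
Qed.

Lemma continuous_correlate rho B BY w :
  continuous (B ^~ w) -> continuous (BY ^~ w) ->
  continuous (correlate rho B BY ^~ w).
Proof.
move=> cB cBY u; apply: cvgD; apply: cvgMr; [exact: cB|exact: cBY].
Qed.

Lemma adapted_correlate rho B BY :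
  adapted B -> adapted BY -> adapted (correlate rho B BY).
Proof.
move=> aB aBY u u0; apply: measurable_funD; apply: measurable_funM => //;
  [exact: aB|exact: aBY].
Qed.

Variables (X Y : R -> Omega -> R) (eta nu rho : R).
Hypotheses (cX : forall w, continuous (X ^~ w)) (aX : adapted X).
Hypotheses (cY : forall w, continuous (Y ^~ w)) (aY : adapted Y).

(** The induction carries all four properties at once: the next hitting time needs a continuous
    adapted motion, and the next motion needs a nonnegative stopping time. *)
Lemma switching_adapted k : let S := switching eta nu rho X Y k in
  [/\ forall w, (0 <= S.1 w)%E, stopping_time S.1,
      forall w, continuous (S.2 ^~ w) & adapted S.2].
Proof.
elim: k => [|k] /=.
  split=> //.
  - move=> u u0; rewrite (_ : [set w | _] = setT).
      exact: (@measurableT _ (g_sigma_algebraType (G u))).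
    by apply/seteqP; split=> // w _ /=; rewrite lee_fin.
  - by move=> w u; apply: cvgN; exact: cX.
  - move=> u u0; apply: measurable_funN; exact: aX.
case: (switching eta nu rho X Y k) => tau B /= [tau0 st cB aB].
set Z := fun t w => _; set tau' := hitting_time _ _ _.
have cZ w : continuous (Z ^~ w).
  by move=> u; apply: cvgB; [exact: cX|exact: continuous_correlate].
have aZ : adapted Z.
  by move=> u u0; apply: measurable_funB; [exact: aX|exact: adapted_correlate].
have tau'0 w : (0 <= tau' w)%E by rewrite (le_trans (tau0 w)) ?hitting_time_ge.
have st' : stopping_time tau' by exact: stopping_time_hitting_time.
split=> //.
- by move=> w; exact: continuous_reflection.
- exact: adapted_reflection.
Qed.

End adapted_processes.

(** * Limits of tail probabilities and the exchange of two increments *)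

Section swap_increments.
Context d (T : measurableType d) (R : realType).

Lemma measurable_preimage (f : T -> R) (C : set R) :
  measurable_fun setT f -> measurable C -> measurable (f @^-1` C).
Proof. by move=> mf mC; rewrite -[_ @^-1` _]setTI; exact: mf. Qed.

Lemma measurable_le_fun (f : T -> R) (z : R) :
  measurable_fun setT f -> measurable [set w | z <= f w].
Proof.
move=> mf; rewrite (_ : [set w | z <= f w] = f @^-1` [set` `[z, +oo[]).
  exact: measurable_preimage.
by apply/seteqP; split=> w /=; rewrite in_itv/= andbT.
Qed.

(* Fatou's lemma for the events [y - e <= U m] and its reverse for
   [y - e <= V m]; letting [e] go to 0 avoids any continuity of the limit laws. *)
Lemma measure_ge_cvg (mu : {measure set T -> \bar R}) (U_ V_ : nat -> T -> R)
    (U V : T -> R) (y : R) : (mu setT < +oo)%E ->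
  (forall m, measurable_fun setT (U_ m)) ->
  (forall m, measurable_fun setT (V_ m)) ->
  (forall w, U_ ^~ w @ \oo --> U w) -> (forall w, V_ ^~ w @ \oo --> V w) ->
  (forall m z, mu [set w | (z <= U_ m w)%R] <= mu [set w | (z <= V_ m w)%R])%E ->
  (mu [set w | (y <= U w)%R] <= mu [set w | (y <= V w)%R])%E.
Proof.
move=> muT mU_ mV_ UU VV UV.
have mu_lt A : measurable A -> (mu A < +oo)%E.
  by move=> mA; apply: le_lt_trans muT; apply: le_measure; rewrite ?inE.
have mU : measurable_fun setT U by apply: measurable_fun_cvg mU_ _ => w _; exact: UU.
have mV : measurable_fun setT V by apply: measurable_fun_cvg mV_ _ => w _; exact: VV.
have step z : z < y -> (mu [set w | (y <= U w)%R] <= mu [set w | (z <= V w)%R])%E.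
  move=> zy.
  (* The union of the [E m] is the lower limit of the events [z <= U_ l], and the intersection of
     the [H m] is the upper limit of the events [z <= V_ l]. *)
  pose E m := \bigcap_(l in [set l | (m <= l)%N]) [set w | z <= U_ l w].
  pose H m := \bigcup_(l in [set l | (m <= l)%N]) [set w | z <= V_ l w].
  have mE m : measurable (E m).
    by apply: bigcap_measurable => [|l _]; [exists m => /=|exact: measurable_le_fun].
  have mH m : measurable (H m) by apply: bigcup_measurable => l _; exact: measurable_le_fun.
  have Ecvg : mu (E m) @[m --> \oo] --> mu (\bigcup_m E m).
    apply: nondecreasing_cvg_mu => //; first exact: bigcup_measurable.
    move=> m l ml; apply/subsetPset => w Em k /= lk.
    by apply: Em => /=; exact: leq_trans lk.
  have Hcvg : mu (H m) @[m --> \oo] --> mu (\bigcap_m H m).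
    apply: nonincreasing_cvg_mu => //; [exact: mu_lt|exact: bigcap_measurable|].
    move=> m l ml; apply/subsetPset => w [k /= lk Vk].
    by exists k => //=; exact: leq_trans lk.
  apply: (@le_trans _ _ (mu (\bigcup_m E m))).
    apply: le_measure; rewrite ?inE; [exact: measurable_le_fun|exact: bigcup_measurable|].
    move=> w /= yU.
    have /cvgrPdist_lt/(_ (U w - z)) := UU w.
    rewrite subr_gt0 (lt_le_trans zy)// => /(_ isT)[m _ mP].
    exists m => // l /= ml; have := mP l ml => /=.
    by move=> /(le_lt_trans (ler_norm _)); rewrite ltrD2l ltrN2 => /ltW.
  apply: (@le_trans _ _ (mu (\bigcap_m H m))).
    rewrite -(cvg_lim _ Ecvg)// -(cvg_lim _ Hcvg)//; apply: lee_lim;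
      [by apply: cvgP Ecvg|by apply: cvgP Hcvg|apply: nearW => m].
    apply: (@le_trans _ _ (mu [set w | z <= U_ m w])).
      by apply: le_measure; rewrite ?inE//; [exact: measurable_le_fun|move=> w; apply => /=].
    apply: (le_trans (UV m z)); apply: le_measure; rewrite ?inE//.
      exact: measurable_le_fun.
    by move=> w Vw; exists m => /=.
  apply: le_measure; rewrite ?inE; [exact: bigcap_measurable|exact: measurable_le_fun|].
  move=> w /= Hw; rewrite leNgt; apply/negP => Vz.
  have /cvgrPdist_lt/(_ (z - V w)) := VV w.
  rewrite subr_gt0 Vz => /(_ isT)[m _ mP].
  have [l /= ml zV] := Hw m I; have := mP l ml => /=.
  by rewrite distrC => /(le_lt_trans (ler_norm _)); rewrite ltrD2r ltNge zV.
pose K j := [set w | y - j.+1%:R^-1 <= V w].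
have Kcvg : mu (K j) @[j --> \oo] --> mu (\bigcap_j K j).
  apply: nonincreasing_cvg_mu => //.
  - by apply: mu_lt; exact: measurable_le_fun.
  - by move=> j; exact: measurable_le_fun.
  - by apply: bigcap_measurable => // j _; exact: measurable_le_fun.
  - move=> j l jl; apply/subsetPset => w /=; apply: le_trans.
    by rewrite lerD2l lerN2 lef_pV2 ?posrE ?ltr0n// ler_nat ltnS.
rewrite (_ : [set w | y <= V w] = \bigcap_j K j); last first.
  apply/seteqP; split=> w /=.
    by move=> yV j _; apply: le_trans yV; rewrite gerBl.
  move=> KV; rewrite leNgt; apply/negP => /ltr_add_invr[j].
  by rewrite -ltrBrDr ltNge => /negP; apply; exact: (KV j I).
apply: (cvge_ge _ Kcvg); apply: nearW => j; apply: step.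
by rewrite gtrBl invr_gt0 ltr0n.
Qed.


(** Adding [N] to both events changes neither measure and makes the events equal. *)
Lemma measure_eq_off_null (mu : {measure set T -> \bar R}) (N A B : set T) :
  measurable N -> measurable A -> measurable B -> mu N = 0 ->
  (forall w, ~ N w -> A w <-> B w) -> mu A = mu B.
Proof.
move=> mN mA mB N0 AB; rewrite -(measureU0 mA mN N0) -(measureU0 mB mN N0).
congr (mu _); apply/seteqP; split=> w.
  by have [|/AB[ABw _]] := pselect (N w); [right|case=> [/ABw|]; [left|right]].
by have [|/AB[_ BAw]] := pselect (N w); [right|case=> [/BAw|]; [left|right]].
Qed.

(** Lebesgue measure and the centred density are both invariant under [x |-> - x]. *)
Lemma normal_prob_opp (s : R) (V : set R) : s != 0 -> measurable V ->
  normal_prob 0 s (-%R @^-1` V) = normal_prob 0 s V.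
Proof.
move=> s0 mV; rewrite /normal_prob [RHS](_ : _ =
  \int[pushforward lebesgue_measure (-%R : _ -> measurableTypeR R)]_(x in V)
    (normal_pdf 0 s x)%:E)%E; last first.
  by apply: eq_measure_integral => /= A mA AS; exact/esym/lebesgue_measureN.
rewrite ge0_integral_pushforward//=.
- apply: eq_integral => x _ /=; congr EFin.
  by rewrite /normal_pdf (negbTE s0) /normal_fun !subr0 sqrrN.
- by apply/measurable_EFinP/measurable_funTS; exact: measurable_normal_pdf.
- by move=> x _; rewrite lee_fin normal_pdf_ge0.
Qed.

(* The pi-lambda theorem is used twice: for the conditioning event, then for
   the pair of increments. *)
Lemma swap_increments_sigma (P : probability T R) (G : set_system T)
    (DX DY : T -> R) :
  G `<=` measurable -> setI_closed G -> G setT ->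
  measurable_fun setT DX -> measurable_fun setT DY ->
  (forall E C D, G E -> measurable C -> measurable D ->
    P (E `&` (DX @^-1` C `&` DY @^-1` D)) =
    P (E `&` (DY @^-1` (-%R @^-1` C) `&` DX @^-1` (-%R @^-1` D)))) ->
  forall E a b y, <<s G >> E ->
    P (E `&` [set w | y <= a * DX w - b * DY w]) =
    P (E `&` [set w | y <= b * DX w - a * DY w]).
Proof.
move=> Gm GI GT mDX mDY GP E a b y GE.
have mN (C : set R) : measurable C -> measurable (-%R @^-1` C).
  by move=> mC; rewrite -[_ @^-1` _]setTI; exact: (measurable_funN (@measurable_id _ _ setT)).
have EP C D : measurable C -> measurable D ->
    P (E `&` (DX @^-1` C `&` DY @^-1` D)) =
    P (E `&` (DY @^-1` (-%R @^-1` C) `&` DX @^-1` (-%R @^-1` D))).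
  move=> mC mD.
  have mS1 : measurable (DX @^-1` C `&` DY @^-1` D) by apply: measurableI; exact: measurable_preimage.
  have mS2 : measurable (DY @^-1` (-%R @^-1` C) `&` DX @^-1` (-%R @^-1` D)).
    by apply: measurableI; apply: measurable_preimage => //; exact: mN.
  (* Both sides are finite measures in the conditioning event, and they agree on the pi-system
     [G]. *)
  apply: (g_sigma_algebra_measure_unique G Gm (fun=> setT) _ _
    (mrestr P mS1) (mrestr P mS2)) => //.
  - by apply/seteqP; split=> // w _; exists 0%N.
  - by move=> A GA; rewrite /mrestr/=; exact: GP.
  - by move=> k; rewrite /= /mrestr setTI (le_lt_trans (probability_le1 _ _)) ?ltry.
have mE : measurable E by move: E GE {EP}; apply: smallest_sub => //; exact: sigma_algebra_measurable.
have mf1 : measurable_fun [set: T] (fun w => (DX w, DY w)) by exact: measurable_fun_pair.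
have mf2 : measurable_fun [set: T] (fun w => (- DY w, - DX w)).
  by apply: measurable_fun_pair; exact: measurable_funN.
pose f1 : {mfun T >-> _} := mfun_Sub (mem_set mf1).
pose f2 : {mfun T >-> _} := mfun_Sub (mem_set mf2).
(* This half-plane pulls back to [y <= a * DX - b * DY] under [f1] and to [y <= b * DX - a * DY]
   under [f2]. *)
pose S := [set p : R * R | y <= a * p.1 - b * p.2].
have mS : measurable S.
  have mg : measurable_fun [set: R * R] (fun p => a * p.1 - b * p.2).
    by apply: measurable_funB; apply: measurable_funM.
  rewrite -[S]setTI (_ : S = (fun p => a * p.1 - b * p.2) @^-1` [set` `[y, +oo[]).
    exact: mg.
  by apply/seteqP; split=> p /=; rewrite in_itv/= andbT.
pose rect := [set A `*` B | A in @measurable _ R & B in @measurable _ R].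
have : pushforward (mrestr P mE) f1 S = pushforward (mrestr P mE) f2 S.
  apply: (g_sigma_algebra_measure_unique rect _ (fun=> setT) _ _
    (pushforward (mrestr P mE) f1) (pushforward (mrestr P mE) f2)).
  - by move=> _ [A mA [B mB <-]]; exact: measurableX.
  - by move=> _; exists setT => //; exists setT => //; rewrite setXTT.
  - by apply/seteqP; split=> // w _; exists 0%N.
  - move=> _ _ [A mA [B mB <-]] [A' mA' [B' mB' <-]].
    exists (A `&` A'); first exact: measurableI.
    by exists (B `&` B'); [exact: measurableI|rewrite setXI].
  - move=> _ [A mA [B mB <-]]; have := EP A B mA mB.
    by rewrite setIC [in RHS]setIC; exact.
  - move=> k; rewrite /= /pushforward /mrestr preimage_setT setTI.
    by rewrite (le_lt_trans (probability_le1 _ _)) ?ltry.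
  - by rewrite -measurable_prod_measurableType.
rewrite /pushforward /mrestr setIC => ->; rewrite setIC.
congr (P (_ `&` _)); apply/seteqP; split=> w; rewrite /S /=.
  by rewrite !mulrN opprK addrC.
by rewrite !mulrN opprK addrC.
Qed.

End swap_increments.

(** * The exchange of increments after a stopping time *)

Section swap_at_stopping_time.
Context d (T : measurableType d) (R : realType) (P : probability T R).
Variable G : R -> set_system T.
Hypothesis Gle : forall s u : R, 0 <= s -> s <= u -> G s `<=` G u.
Hypothesis Gm : forall u : R, 0 <= u -> G u `<=` measurable.

Lemma sigma_filtration_measurable (u : R) : 0 <= u -> <<s G u >> `<=` measurable.
Proof.
by move=> u0; apply: smallest_sub; [exact: sigma_algebra_measurable|exact: Gm].
Qed.

Lemma filtration_measurable_fun (u : R) (f : T -> R) : 0 <= u ->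
  measurable_fun [set: g_sigma_algebraType (G u)] f -> measurable_fun [set: T] f.
Proof.
by move=> u0 mf _ C mC; apply: (sigma_filtration_measurable u0); exact: mf.
Qed.

Variables (X Y : R -> T -> R).
Hypotheses (cX : forall w, continuous (X ^~ w)) (aX : adapted G X).
Hypotheses (cY : forall w, continuous (Y ^~ w)) (aY : adapted G Y).
Hypothesis swapXY : forall (q t : R) E a b y, 0 <= q -> q <= t -> <<s G q >> E ->
  P (E `&` [set w | y <= a * (X t w - X q w) - b * (Y t w - Y q w)]) =
  P (E `&` [set w | y <= b * (X t w - X q w) - a * (Y t w - Y q w)]).

(** For the discretised time the two probabilities are equal, as sums over its values of the
    identity at fixed times. Only the passage to the limit weakens this to an inequality. *)
Lemma stopping_time_swap_le (t : R) (tau : T -> \bar R) a b y : 0 <= t ->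
  (forall w, 0 <= tau w)%E -> stopping_time G tau ->
  (P ([set w | (tau w <= t%:E)%E] `&`
      [set w | (y <= a * (X t w - stopped_value t tau X w)
                    - b * (Y t w - stopped_value t tau Y w))%R]) <=
   P ([set w | (tau w <= t%:E)%E] `&`
      [set w | (y <= b * (X t w - stopped_value t tau X w)
                    - a * (Y t w - stopped_value t tau Y w))%R]))%E.
Proof.
move=> t0 tau0 st; pose A := [set w | (tau w <= t%:E)%E].
have mA : measurable A by apply: (sigma_filtration_measurable t0); exact: st.
pose U_ (a b : R) m w := a * (X t w - grid_value t m tau X w)
  - b * (Y t w - grid_value t m tau Y w).
have mU_ a' b' m : measurable_fun setT (U_ a' b' m).
  apply: measurable_funB; apply: measurable_funM => //; apply: measurable_funB;
    apply: (filtration_measurable_fun t0); try exact: measurable_grid_value.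
  - exact: aX.
  - exact: aY.
have U_cvg a' b' w : U_ a' b' m w @[m --> \oo] -->
    a' * (X t w - stopped_value t tau X w) - b' * (Y t w - stopped_value t tau Y w).
  apply: cvgB; apply: cvgMr; apply: cvgB; try exact: cvg_cst; exact: grid_value_cvg.
have decomp a' b' m z : P ([set w | z <= U_ a' b' m w] `&` A) =
    (\sum_(k < m.+2) P ([set w | (tau w <= t%:E)%E /\ grid_index t m tau w = k] `&`
      [set w | z <= a' * (X t w - X (grid t m k) w)
                    - b' * (Y t w - Y (grid t m k) w)]%R))%E.
  pose F k := [set w | (tau w <= t%:E)%E /\ grid_index t m tau w = k] `&`
      [set w | z <= a' * (X t w - X (grid t m k) w)
                    - b' * (Y t w - Y (grid t m k) w)].
  have mF k : (k < m.+2)%N -> measurable (F k).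
    move=> km; have q0 := grid_ge0 m k t0; apply: measurableI.
      by apply: (sigma_filtration_measurable q0); exact: grid_index_eq.
    apply: measurable_le_fun.
    apply: measurable_funB; apply: measurable_funM => //; apply: measurable_funB;
      by [apply: (filtration_measurable_fun t0); auto|
          apply: (filtration_measurable_fun q0); auto].
  rewrite -(@measure_semi_additive_ord_I _ _ _ P F)//; last 2 first.
  - by move=> i j _ _ [w [[[_ <-] _] [[_ <-] _]]].
  - apply: bigsetU_measurable => k _; exact: mF.
  rewrite -bigcup_mkord; congr (P _); apply/seteqP; split=> w /=.
    move=> [Uw Aw]; exists (grid_index t m tau w).
      by rewrite /= ltnS grid_index_max.
    by split=> //=; move: Uw; rewrite /U_ !grid_valueE.
  by move=> [k _ [[Aw <-] /= Uw]]; split=> //; rewrite /U_ !grid_valueE.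
rewrite -/A ![A `&` _]setIC.
apply: (@measure_ge_cvg _ _ _ (mrestr P mA) (U_ a b) (U_ b a)) => //.
  by rewrite /= /mrestr setTI (le_lt_trans (probability_le1 _ _)) ?ltry.
move=> m z; rewrite /= /mrestr !decomp le_eqVlt; apply/orP; left; apply/eqP.
apply: eq_bigr => k _; have km : (k <= m.+1)%N by rewrite -ltnS.
by apply: swapXY; rewrite ?grid_ge0 ?grid_le//; exact: grid_index_eq.
Qed.

(** The inequality holds for all [a] and [b], so exchanging them gives its reverse. *)
Lemma stopping_time_swap (t : R) (tau : T -> \bar R) a b y : 0 <= t ->
  (forall w, 0 <= tau w)%E -> stopping_time G tau ->
  P ([set w | (tau w <= t%:E)%E] `&`
      [set w | y <= a * (X t w - stopped_value t tau X w)
                    - b * (Y t w - stopped_value t tau Y w)]) =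
  P ([set w | (tau w <= t%:E)%E] `&`
      [set w | y <= b * (X t w - stopped_value t tau X w)
                    - a * (Y t w - stopped_value t tau Y w)]).
Proof.
by move=> t0 tau0 st; apply/eqP; rewrite eq_le !stopping_time_swap_le.
Qed.

End swap_at_stopping_time.

(** * Brownian motions, their joint filtration and versions with continuous paths *)

Lemma continuous_max0 (R : realType) (f : R -> R) :
  {within `[0, +oo[, continuous f} -> continuous (fun u : R => f (Num.max u 0)).
Proof.
move=> /subspace_continuousP cf u S Sf.
have mu0 : `[0, +oo[%classic (Num.max u 0) by rewrite /= in_itv/= le_max lexx orbT.
have /(_ _ (cf _ mu0 S Sf)) : Num.max v 0 @[v --> u] --> Num.max u 0.
  by apply: continuous_max; [exact: cvg_id|exact: cvg_cst].
rewrite !nbhs_simpl /=; apply: filterS => v /=; apply.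
by rewrite in_itv/= le_max lexx orbT.
Qed.

Lemma sigma_algebra_setI (T : pointedType) (S : set_system T) A B :
  sigma_algebra setT S -> S A -> S B -> S (A `&` B).
Proof.
move=> /sigma_algebra_id <-.
exact: (@measurableI _ (g_sigma_algebraType S)).
Qed.

Section brownian_filtration.
Context d (T : measurableType d) (R : realType) (P : probability T R).
Variables (F : R -> set_system T) (BX BY : R -> T -> R).
Hypotheses (filtF : filtration F).
Hypotheses (bmX : brownian_motion P F BX) (bmY : brownian_motion P F BY).
Hypothesis indXY : independent P (sigma_process BX) (sigma_process BY).

Let FT (u : R) : 0 <= u -> F u setT.
Proof.
by move=> u0; have [F0 FC _] := filtration_sigma_algebra filtF u0;
  rewrite -(setD0 setT); exact: FC.
Qed.

Lemma sigma_process_setT (B : R -> T -> R) : sigma_process B setT.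
Proof. exact: (@measurableT _ (g_sigma_algebraType _)). Qed.

Lemma sigma_process_setI (B : R -> T -> R) A A' :
  sigma_process B A -> sigma_process B A' -> sigma_process B (A `&` A').
Proof. exact: (@measurableI _ (g_sigma_algebraType _)). Qed.

Lemma sigma_process_preimage (B : R -> T -> R) (u : R) C : 0 <= u -> measurable C ->
  sigma_process B (B u @^-1` C).
Proof.
move=> u0 mC; apply: sub_sigma_algebra; exists u => //=.
by exists C => //; rewrite setTI.
Qed.

Lemma sigma_process_increment (B : R -> T -> R) (s u : R) C : 0 <= s -> 0 <= u ->
  measurable C -> sigma_process B ((B u \- B s) @^-1` C).
Proof.
move=> s0 u0 mC; rewrite -[_ @^-1` _]setTI.
pose S := g_sigma_algebraType (\bigcup_(t in [set t | 0 <= t]) sigma_rv (B t)).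
have mB v : 0 <= v -> measurable_fun [set: S] (B v).
  by move=> v0 _ D mD; rewrite setTI; exact: sigma_process_preimage.
have mD : measurable_fun [set: S] (B u \- B s) by apply: measurable_funB; exact: mB.
exact: mD.
Qed.

Lemma brownian_measurable B (u : R) : brownian_motion P F B -> 0 <= u ->
  measurable_fun setT (B u).
Proof.
move=> bmB u0 _ C mC; apply: (filtration_measurable filtF u0).
by apply: (bm_adapted bmB u0); exists C.
Qed.

(* The joint natural filtration, with a null set [N] adjoined. Its first factors
   are taken in [F u] so that [bm_independent_increments] applies, and in the
   sigma-algebra of their own process, since the increments of [BX] and [BY]
   are only assumed to be separately independent of [F u]. *)
Definition joint_filtration (N : set T) (u : R) : set_system T :=
  [set E | exists A B K, [/\ F u A /\ sigma_process BX A,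
    F u B /\ sigma_process BY B, K = setT \/ K = ~` N & E = A `&` B `&` K]].

Variable N : set T.
Hypotheses (mN : measurable N) (PN : P N = 0).
Local Notation G := (joint_filtration N).

Lemma joint_filtration_le (s u : R) : 0 <= s -> s <= u -> G s `<=` G u.
Proof.
move=> s0 su _ [A [B [K [[FA XA] [FB YB] NK ->]]]].
by exists A, B, K; split=> //; split=> //; exact: (filtration_le filtF s0 su).
Qed.

Lemma joint_filtration_measurable (u : R) : 0 <= u -> G u `<=` measurable.
Proof.
move=> u0 _ [A [B [K [[FA _] [FB _] NK ->]]]].
apply: measurableI; last by case: NK => ->; [|exact: measurableC].
by apply: measurableI; exact: (filtration_measurable filtF u0).
Qed.

Lemma joint_filtration_setT (u : R) : 0 <= u -> G u setT.
Proof.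
move=> u0; exists setT, setT, setT; rewrite !setIT.
by split=> //; [split; [exact: FT|exact: sigma_process_setT]..|left].
Qed.

Lemma joint_filtration_setI (u : R) : 0 <= u -> setI_closed (G u).
Proof.
move=> u0 _ _ [A [B [K [[FA XA] [FB YB] NK ->]]]] [A' [B' [K' [[FA' XA'] [FB' YB'] NK' ->]]]].
have sF := filtration_sigma_algebra filtF u0.
exists (A `&` A'), (B `&` B'), (K `&` K'); split.
- by split; [exact: sigma_algebra_setI|exact: sigma_process_setI].
- by split; [exact: sigma_algebra_setI|exact: sigma_process_setI].
- by case: NK NK' => -> [] ->; rewrite ?setTI ?setIT ?setIid; [left|right..].
- by rewrite setIACA; congr (_ `&` _); rewrite setIACA.
Qed.

(** [A] with the [BX] increment is independent of [B] with the [BY] increment, and each increment is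
    independent of its own factor. The probability therefore splits into four factors, and the
    common symmetric normal law makes the exchange invisible. *)
Lemma joint_filtration_rectangle (q t : R) E C D : 0 <= q -> q < t -> G q E ->
    measurable C -> measurable D ->
  P (E `&` ((BX t \- BX q) @^-1` C `&` (BY t \- BY q) @^-1` D)) =
  P (E `&` ((BY t \- BY q) @^-1` (-%R @^-1` C) `&`
            (BX t \- BX q) @^-1` (-%R @^-1` D))).
Proof.
move=> q0 qt [A [B [K [[FA XA] [FB YB] NK ->]]]].
have t0 : 0 <= t by rewrite (le_trans q0)// ltW.
have s0 : Num.sqrt (t - q) != 0 by rewrite gt_eqF// sqrtr_gt0 subr_gt0.
have mFq := filtration_measurable filtF q0.
have mDX : measurable_fun setT (BX t \- BX q).
  by apply: measurable_funB; exact: brownian_measurable.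
have mDY : measurable_fun setT (BY t \- BY q).
  by apply: measurable_funB; exact: brownian_measurable.
have rect U V : measurable U -> measurable V ->
    P (A `&` B `&` K `&` ((BX t \- BX q) @^-1` U `&` (BY t \- BY q) @^-1` V)) =
    (P A * normal_prob 0 (Num.sqrt (t - q)) U *
     (P B * normal_prob 0 (Num.sqrt (t - q)) V))%E.
  move=> mU mV.
  have mS : measurable ((BX t \- BX q) @^-1` U `&` (BY t \- BY q) @^-1` V).
    by apply: measurableI; exact: measurable_preimage.
  transitivity (P ((A `&` (BX t \- BX q) @^-1` U) `&`
                   (B `&` (BY t \- BY q) @^-1` V))).
    apply: (measure_eq_off_null mN _ _ PN).
    - apply: measurableI => //; apply: (joint_filtration_measurable q0).
      by exists A, B, K.
    - by apply: measurableI; apply: measurableI; [exact: mFq|exact: measurable_preimage..|exact: mFq|exact: measurable_preimage].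
    - move=> w Nw /=; split=> [[[[]]]|]; first tauto.
      by move=> [[? ?] [? ?]]; do !split => //; case: NK => ->.
  rewrite indXY; last 2 first.
  - by apply: sigma_process_setI => //; exact: sigma_process_increment.
  - by apply: sigma_process_setI => //; exact: sigma_process_increment.
  rewrite (bm_independent_increments bmX q0 qt)//; last by exists U; rewrite ?setTI.
  rewrite (bm_independent_increments bmY q0 qt)//; last by exists V; rewrite ?setTI.
  by rewrite (bm_normal_increments bmX q0 qt)// (bm_normal_increments bmY q0 qt).
move=> mC mD; have mopp (U : set R) : measurable U -> measurable (-%R @^-1` U).
  move=> mU; rewrite -[_ @^-1` _]setTI.
  exact: (measurable_funN (@measurable_id _ _ setT)).
rewrite [in RHS](setIC (_ @^-1` _)).
rewrite !rect ?normal_prob_opp//; try exact: mopp.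
by rewrite muleACA [RHS]muleACA; congr (_ * _)%E; rewrite muleC.
Qed.

Lemma joint_filtration_swap (q t : R) E a b y : 0 <= q -> q <= t ->
  <<s G q >> E ->
  P (E `&` [set w | y <= a * (BX t w - BX q w) - b * (BY t w - BY q w)]) =
  P (E `&` [set w | y <= b * (BX t w - BX q w) - a * (BY t w - BY q w)]).
Proof.
move=> q0; rewrite le_eqVlt => /predU1P[<- _|qt GE].
  (* For [q = t] both increments vanish; the laws of increments are given for [q < t]. *)
  by congr (P (_ `&` _)); apply/seteqP; split=> w /=; rewrite !subrr !mulr0.
have t0 : 0 <= t by rewrite (le_trans q0)// ltW.
apply: (swap_increments_sigma (joint_filtration_measurable q0)
  (joint_filtration_setI q0) (joint_filtration_setT q0)) => //.
- by apply: measurable_funB; exact: brownian_measurable.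
- by apply: measurable_funB; exact: brownian_measurable.
- by move=> E' C D; exact: joint_filtration_rectangle.
Qed.

(** Zero on [N] and frozen at the initial value for negative times: every path becomes continuous on
    the whole line, and the pathwise arguments have no exceptional set. *)
Definition regularize (B : R -> T -> R) (u : R) (w : T) : R :=
  if w \in N then 0 else B (Num.max u 0) w.

Lemma regularizeE (B : R -> T -> R) (u : R) w : ~ N w -> 0 <= u -> regularize B u w = B u w.
Proof. by move=> Nw u0; rewrite /regularize memNset// max_l. Qed.

Lemma continuous_regularize (B : R -> T -> R) :
  (forall w, ~ N w -> {within `[0, +oo[, continuous (B ^~ w)}) ->
  forall w, continuous (regularize B ^~ w).
Proof.
move=> cB w; have [Nw|Nw] := pselect (N w).
  rewrite (_ : regularize B ^~ w = cst 0); first by move=> u; exact: cvg_cst.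
  by apply/funext => u; rewrite /regularize mem_set.
rewrite (_ : regularize B ^~ w = fun u => B (Num.max u 0) w).
  by apply: (@continuous_max0 _ (B ^~ w)); exact: cB.
by apply/funext => u; rewrite /regularize memNset.
Qed.

Let adapted_regularize (B : R -> T -> R) :
  (forall u C, 0 <= u -> measurable C -> G u (B u @^-1` C)) ->
  adapted G (regularize B).
Proof.
move=> GB u u0.
rewrite (_ : regularize B u = fun w => if w \in N then 0 else B u w); last first.
  by apply/funext => w; rewrite /regularize max_l.
apply: measurable_fun_ifT => //.
- apply: (measurable_fun_bool false); rewrite setTI.
  rewrite (_ : _ @^-1` _ = ~` N).
    (* The factor [K] in [joint_filtration] makes the complement of [N] measurable at every time. *)
    apply: sub_sigma_algebra; exists setT, setT, (~` N); rewrite !setTI.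
    by split=> //; [split; [exact: FT|exact: sigma_process_setT]..|right].
  by apply/seteqP; split=> w /=; [move/negbT; rewrite notin_setE|exact: memNset].
- by move=> _ C mC; rewrite setTI; apply: sub_sigma_algebra; exact: GB.
Qed.

Lemma adapted_regularizeX : adapted G (regularize BX).
Proof.
apply: adapted_regularize => u C u0 mC; exists (BX u @^-1` C), setT, setT.
rewrite !setIT; split=> //; [split|split|by left].
- by apply: (bm_adapted bmX u0); exists C; rewrite ?setTI.
- exact: sigma_process_preimage.
- exact: FT.
- exact: sigma_process_setT.
Qed.

Lemma adapted_regularizeY : adapted G (regularize BY).
Proof.
apply: adapted_regularize => u C u0 mC; exists setT, (BY u @^-1` C), setT.
rewrite setTI setIT; split=> //; [split|split|by left].
- exact: FT.
- exact: sigma_process_setT.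
- by apply: (bm_adapted bmY u0); exists C; rewrite ?setTI.
- exact: sigma_process_preimage.
Qed.

Lemma regularize_swap (q t : R) E a b y : 0 <= q -> q <= t -> <<s G q >> E ->
  let X := regularize BX in let Y := regularize BY in
  P (E `&` [set w | y <= a * (X t w - X q w) - b * (Y t w - Y q w)]) =
  P (E `&` [set w | y <= b * (X t w - X q w) - a * (Y t w - Y q w)]).
Proof.
move=> q0 qt GE X Y; have t0 := le_trans q0 qt.
have mE := sigma_filtration_measurable joint_filtration_measurable q0 GE.
have mX u : 0 <= u -> measurable_fun setT (X u).
  move=> u0; apply: (filtration_measurable_fun joint_filtration_measurable u0).
  exact: adapted_regularizeX.
have mY u : 0 <= u -> measurable_fun setT (Y u).
  move=> u0; apply: (filtration_measurable_fun joint_filtration_measurable u0).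
  exact: adapted_regularizeY.
have mS (X1 X2 Y1 Y2 : T -> R) a' b' : measurable_fun setT X1 ->
    measurable_fun setT X2 -> measurable_fun setT Y1 -> measurable_fun setT Y2 ->
    measurable (E `&` [set w | y <= a' * (X1 w - X2 w) - b' * (Y1 w - Y2 w)]).
  move=> mX1 mX2 mY1 mY2; apply: measurableI => //; apply: measurable_le_fun.
  by apply: measurable_funB; apply: measurable_funM => //; exact: measurable_funB.
have PE a' b' : P (E `&` [set w | y <= a' * (X t w - X q w) - b' * (Y t w - Y q w)])
    = P (E `&` [set w | y <= a' * (BX t w - BX q w) - b' * (BY t w - BY q w)]).
  apply: (measure_eq_off_null mN _ _ PN).
  - by apply: mS; auto.
  - by apply: mS; exact: brownian_measurable.
  - by move=> w Nw; rewrite /X /Y /= !regularizeE.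
by rewrite !PE; exact: joint_filtration_swap.
Qed.

End brownian_filtration.

(** * Pathwise behaviour at and after a switching time *)

Section switching_paths.
Context (Omega : Type) (R : realType).
Variables (eta nu rho : R).
Implicit Types (BX BY : R -> Omega -> R) (w : Omega).
Local Notation S BX BY := (switching eta nu rho BX BY).
Local Notation Z BX BY k t w := (BX t w - Y eta nu rho BX BY k t w).

Lemma switching_timeS BX BY k : (S BX BY k.+1).1 =
  hitting_time (fun t w => Z BX BY k t w) (level eta nu k.+1) (S BX BY k).1.
Proof. by rewrite /Y /=; case: (S BX BY k). Qed.

Lemma switching_motionS BX BY k : (S BX BY k.+1).2 =
  reflection (S BX BY k).2 (S BX BY k.+1).1.
Proof. by rewrite /=; case: (S BX BY k). Qed.

Lemma switching_time_le BX BY k w : ((S BX BY k).1 w <= (S BX BY k.+1).1 w)%E.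
Proof. by rewrite switching_timeS; exact: hitting_time_ge. Qed.

Lemma switching_time_ge0 BX BY k w : (0 <= (S BX BY k).1 w)%E.
Proof. by elim: k => // k /le_trans; apply; exact: switching_time_le. Qed.

(** Switching times are nonnegative, so the construction reads the paths at nonnegative times only.
    This carries results from the regularised motions to the original ones. *)
Lemma switching_ext BX BY BX' BY' w :
  (forall u, 0 <= u -> BX u w = BX' u w) -> (forall u, 0 <= u -> BY u w = BY' u w) ->
  forall k, (S BX BY k).1 w = (S BX' BY' k).1 w /\
    forall u, 0 <= u -> (S BX BY k).2 u w = (S BX' BY' k).2 u w.
Proof.
move=> XX YY; elim=> [|k [tauE BE]]; first by split=> // u u0 /=; rewrite XX.
have tauSE : (S BX BY k.+1).1 w = (S BX' BY' k.+1).1 w.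
  rewrite !switching_timeS /hitting_time.
  congr (ereal_inf (EFin @` _)); apply/funext => u.
  rewrite tauE; suff H : ((S BX' BY' k).1 w <= u%:E)%E ->
      Z BX BY k u w = Z BX' BY' k u w.
    by apply/propext; split=> -[su <-]; split=> //; rewrite H.
  move=> /(le_trans (switching_time_ge0 BX' BY' k w)); rewrite lee_fin => u0.
  by rewrite /Y /correlate XX// YY// BE.
split=> // u u0; rewrite !switching_motionS /reflection tauSE !BE//.
by rewrite fine_ge0// switching_time_ge0.
Qed.

Lemma process_ext BX BY BX' BY' w t k : 0 <= t ->
  (forall u, 0 <= u -> BX u w = BX' u w) -> (forall u, 0 <= u -> BY u w = BY' u w) ->
  Z BX BY k t w = Z BX' BY' k t w.
Proof.
move=> t0 XX YY; have [_ BE] := switching_ext XX YY k.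
by rewrite /Y /correlate XX// YY// BE.
Qed.

(** The recursion starts from [- BX] and each reflection reverses the later increments, whence the
    exponent [k.+1]. *)
Lemma switching_increment BX BY k w (u v : R) :
  ((S BX BY k).1 w <= u%:E)%E -> ((S BX BY k).1 w <= v%:E)%E ->
  (S BX BY k).2 v w - (S BX BY k).2 u w = (-1) ^+ k.+1 * (BX v w - BX u w).
Proof.
elim: k => [|k IH] su sv; first by rewrite expr1 /=; ring.
rewrite switching_motionS /reflection su sv exprS -mulrA -IH; first by ring.
- exact: le_trans (switching_time_le _ _ _ _) su.
- exact: le_trans (switching_time_le _ _ _ _) sv.
Qed.

Variables (BX BY : R -> Omega -> R) (w : Omega).
Hypothesis cZ : forall k, continuous (fun t => Z BX BY k t w).

Lemma process_at_switching k (s : R) : (S BX BY k.+1).1 w = s%:E ->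
  Z BX BY k s w = level eta nu k.+1.
Proof. by rewrite switching_timeS => /(hitting_time_eq (@cZ k)). Qed.

Lemma process_before_switching k (t : R) : ~~ ((S BX BY k.+1).1 w <= t%:E)%E ->
  Z BX BY k.+1 t w = Z BX BY k t w.
Proof.
by move=> /negbTE tau; rewrite /Y /correlate switching_motionS /reflection tau.
Qed.

(** Both processes sit at the level at time [s]; from then on their [BX] coefficients are [1 + rho]
    and [1 - rho], in this order for even [k] and in the other for odd [k]. *)
Lemma process_after_switching k (s t : R) : (S BX BY k.+1).1 w = s%:E -> s <= t ->
  Z BX BY k t w = level eta nu k.+1 + ((1 - rho * (-1) ^+ k.+1) * (BX t w - BX s w)
    - Num.sqrt (1 - rho ^+ 2) * (BY t w - BY s w)) /\
  Z BX BY k.+1 t w = level eta nu k.+1 + ((1 - rho * (-1) ^+ k.+2) * (BX t w - BX s w)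
    - Num.sqrt (1 - rho ^+ 2) * (BY t w - BY s w)).
Proof.
move=> taus st; have tauk := switching_time_le BX BY k w; rewrite taus in tauk.
have taut : ((S BX BY k.+1).1 w <= t%:E)%E by rewrite taus lee_fin.
have ZkE : Z BX BY k t w = level eta nu k.+1 +
    ((1 - rho * (-1) ^+ k.+1) * (BX t w - BX s w)
    - Num.sqrt (1 - rho ^+ 2) * (BY t w - BY s w)).
  rewrite -(process_at_switching taus) mulrBl -(mulrA rho).
  rewrite -(@switching_increment BX BY k)//; last exact: le_trans (switching_time_le _ _ _ _) taut.
  by rewrite /Y /correlate; ring.
split=> //; apply/eqP; rewrite -subr_eq0; apply/eqP.
(* The reflection replaces [B t] by [2 * B s - B t] inside [Y], which raises the difference process
   by [2 * rho] times the increment of [B]. *)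
have -> : Z BX BY k.+1 t w = Z BX BY k t w
    + rho * 2 * ((S BX BY k).2 t w - (S BX BY k).2 s w).
  by rewrite /Y /correlate switching_motionS /reflection taut taus /=; ring.
rewrite switching_increment//; last exact: le_trans (switching_time_le _ _ _ _) taut.
by rewrite ZkE !exprS; ring.
Qed.

(* For [rho = 1] the process is frozen at [eta] after an odd switching time. *)
Lemma switching_time_frozen k : rho = 1 -> nu < eta -> odd k ->
  (S BX BY k.+1).1 w = +oo%E.
Proof.
move=> rho1 nueta; case: k => // k oddk.
have := switching_time_le BX BY k.+1 w; have := switching_time_ge0 BX BY k.+1 w.
have := switching_time_ge0 BX BY k.+2 w.
case taus : ((S BX BY k.+2).1 w) => [s||]// s0.
case taur : ((S BX BY k.+1).1 w) => [r||]// r0; rewrite lee_fin => rs.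
(* With [rho = 1] both coefficients vanish after [r], so a finite next time [s] would force
   [nu = eta]. *)
have [_] := process_after_switching taur rs.
rewrite (process_at_switching taus) /level oddk /= negbK.
rewrite /= in oddk; rewrite -signr_odd /= negbK (negbTE oddk) expr0 rho1.
rewrite expr1n mulr1 subrr sqrtr0 !mul0r subrr addr0 => nuE.
by rewrite nuE ltxx in nueta.
Qed.

End switching_paths.

(* [(1 + rho) * v = s * w] and [(1 - rho) * w = s * v], where
   [1 - rho <= s <= 1 + rho]. *)
Lemma swapped_combination (R : realType) (rho p q y : R) : 0 < rho -> rho <= 1 ->
  let s := Num.sqrt (1 - rho ^+ 2) in
  let v := (1 - rho) * p - s * q in let w := s * p - (1 + rho) * q in
  (y <= 0 -> y <= w -> y <= v) /\ (0 <= y -> rho < 1 -> y <= v -> y <= w).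
Proof.
move=> rho0 rho1 s v w.
have s2 : s ^+ 2 = (1 - rho) * (1 + rho).
  by rewrite sqr_sqrtr; [ring|nra].
have s0 : 0 <= s by exact: sqrtr_ge0.
have sub : s <= 1 + rho by nra.
have slb : 1 - rho <= s by nra.
split=> [y0 yw|y0 rholt yv].
- have vE : (1 + rho) * v = s * w.
    have : (1 + rho) * v - s * w = (s ^+ 2 - (1 - rho) * (1 + rho)) * - p.
      by rewrite /v /w; ring.
    by rewrite s2 subrr mul0r => /subr0_eq.
  (* [s * w >= s * y >= (1 + rho) * y], because [y <= 0] and [0 <= s <= 1 + rho]. *)
  nra.
- have wE : (1 - rho) * w = s * v.
    have : (1 - rho) * w - s * v = (s ^+ 2 - (1 - rho) * (1 + rho)) * q.
      by rewrite /v /w; ring.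
    by rewrite s2 subrr mul0r => /subr0_eq.
  (* [s * v >= s * y >= (1 - rho) * y], because [y >= 0] and [s >= 1 - rho]; then [1 - rho > 0] is
     cancelled. *)
  nra.
Qed.

(** * Monotonicity when every path is continuous *)

Section continuous_paths.
Context d (T : measurableType d) (R : realType) (P : probability T R).
Variable G : R -> set_system T.
Hypothesis Gle : forall s u : R, 0 <= s -> s <= u -> G s `<=` G u.
Hypothesis Gm : forall u : R, 0 <= u -> G u `<=` measurable.
Variables (BX BY : R -> T -> R) (eta nu rho : R).
Hypotheses (cX : forall w, continuous (BX ^~ w)) (aX : adapted G BX).
Hypotheses (cY : forall w, continuous (BY ^~ w)) (aY : adapted G BY).
Hypothesis swapXY : forall (q t : R) E a b y, 0 <= q -> q <= t -> <<s G q >> E ->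
  P (E `&` [set w | y <= a * (BX t w - BX q w) - b * (BY t w - BY q w)]) =
  P (E `&` [set w | y <= b * (BX t w - BX q w) - a * (BY t w - BY q w)]).

Lemma measurable_process_ge t x n : 0 <= t ->
  measurable [set w | x <= BX t w - Y eta nu rho BX BY n t w].
Proof.
move=> t0; have [_ _ _ aB] := switching_adapted Gle eta nu rho cX aX cY aY n.
apply/measurable_le_fun/(filtration_measurable_fun Gm t0).
by apply: measurable_funB; [exact: aX|exact: adapted_correlate].
Qed.

Lemma probability_process_ge_le t x n : 0 < rho -> rho <= 1 -> nu < eta ->
  0 <= t -> nu <= x -> x <= eta ->
  (P [set w | x <= BX t w - Y eta nu rho BX BY n t w]%R <=
   P [set w | x <= BX t w - Y eta nu rho BX BY n.+1 t w]%R)%E.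
Proof.
move=> rho0 rho1 nueta t0 nux xeta.
have [tau0 st _ _] := switching_adapted Gle eta nu rho cX aX cY aY n.+1.
set tau := (switching eta nu rho BX BY n.+1).1 in tau0 st.
pose A := [set w | (tau w <= t%:E)%E].
have mA : measurable A by apply: (sigma_filtration_measurable Gm t0); exact: st.
have cZ w k : continuous (fun t => BX t w - Y eta nu rho BX BY k t w).
  have [_ _ cB _] := switching_adapted Gle eta nu rho cX aX cY aY k.
  by move=> u; apply: cvgB; [exact: cX|exact: continuous_correlate].
have mE k : measurable [set w | x <= BX t w - Y eta nu rho BX BY k t w].
  exact: measurable_process_ge.
(* Off [A] the two processes agree at time [t], so only the contributions of [A] have to be
   compared. *)
rewrite (measureDI P (mE n) mA) (measureDI P (mE n.+1) mA); apply: leeD.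
  rewrite le_eqVlt; apply/orP; left; apply/eqP; congr (P _).
  by apply/seteqP; split=> w /= [xZ /negP Aw]; split; [|exact/negP| |exact/negP];
    move: xZ; rewrite process_before_switching.
rewrite ![_ `&` A]setIC.
pose s := Num.sqrt (1 - rho ^+ 2).
pose DX w := BX t w - stopped_value t tau BX w.
pose DY w := BY t w - stopped_value t tau BY w.
have AE k a c : (forall w, A w -> BX t w - Y eta nu rho BX BY k t w =
      a + (c * DX w - s * DY w)) ->
    A `&` [set w | x <= BX t w - Y eta nu rho BX BY k t w] =
    A `&` [set w | x - a <= c * DX w - s * DY w].
  by move=> ZE; apply/seteqP; split=> w /= [Aw]; rewrite ZE// lerBlDl.
have ZE w : A w ->
    BX t w - Y eta nu rho BX BY n t w = level eta nu n.+1
      + ((1 - rho * (-1) ^+ n.+1) * DX w - s * DY w) /\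
    BX t w - Y eta nu rho BX BY n.+1 t w = level eta nu n.+1
      + ((1 - rho * (-1) ^+ n.+2) * DX w - s * DY w).
  rewrite /A /= => Aw; rewrite /DX /DY /stopped_value Aw.
  have := tau0 w; case taus : (tau w) Aw => [r||]//= + _; rewrite lee_fin.
  exact: process_after_switching.
rewrite (AE n _ _ (fun w Aw => (ZE w Aw).1)) (AE n.+1 _ _ (fun w Aw => (ZE w Aw).2)).
have mS c b : measurable (A `&` [set w | x - level eta nu n.+1 <= c * DX w - b * DY w]).
  apply: measurableI => //.
  apply/measurable_le_fun/(filtration_measurable_fun Gm t0).
  apply: measurable_funB; apply: measurable_funM => //; apply: measurable_funB;
    by [exact: aX|exact: aY|exact: measurable_stopped_value].
rewrite -[(-1) ^+ n.+1]signr_odd -[(-1) ^+ n.+2]signr_odd /level /= negbK.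
have [oddn|evenn] := boolP (odd n) => /=; rewrite expr0 expr1 mulrN1 opprK mulr1.
(* The level is [nu] and the later process carries [1 + rho], so the exchange is made on the right;
   the comparison becomes an inclusion of events with [y = x - nu >= 0]. *)
- rewrite [leRHS](stopping_time_swap Gle Gm cX aX cY aY swapXY)//.
  have [rhoE|rhoN1] := eqVneq rho 1.
    rewrite -/A (_ : A = set0) ?set0I//; apply/seteqP; split=> w //=.
    by rewrite /A /= /tau (switching_time_frozen (cZ w) rhoE nueta oddn).
  have := mS (1 - rho) s; have := mS s (1 + rho); rewrite /level /= oddn /= => m1 m2.
  apply: le_measure; rewrite ?inE//.
  move=> w /= [Aw yv]; split=> //.
  have [_ H] := swapped_combination (DX w) (DY w) (x - nu) rho0 rho1.
  by apply: H => //; rewrite ?subr_ge0// lt_neqAle rhoN1.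
(* The level is [eta] and the earlier process carries [1 + rho], so the exchange is made on the
   left, with [y = x - eta <= 0]. *)
- rewrite (stopping_time_swap Gle Gm cX aX cY aY swapXY)//.
  have := mS (1 - rho) s; have := mS s (1 + rho).
  rewrite /level /= (negbTE evenn) /= => m1 m2.
  apply: le_measure; rewrite ?inE//.
  move=> w /= [Aw yv]; split=> //.
  have [H _] := swapped_combination (DX w) (DY w) (x - eta) rho0 rho1.
  by apply: H => //; rewrite subr_le0.
Qed.

End continuous_paths.

(** * Passage to almost surely continuous paths *)

Theorem corollary1 (R : realType) (d : measure_display)
    (Omega : measurableType d) (P : probability Omega R)
    (F : R -> set (set Omega)) (BX BY : R -> Omega -> R)
    (eta nu rho t x : R) :
  filtration F -> usual_conditions P F ->
  brownian_motion P F BX -> brownian_motion P F BY ->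
  independent P (sigma_process BX) (sigma_process BY) ->
  0 < eta -> nu < eta -> 0 < rho -> rho <= 1 ->
  0 < t -> nu <= x -> x <= eta ->
  forall n : nat,
    (P [set w | x <= BX t w - Y eta nu rho BX BY n t w]%R <=
     P [set w | x <= BX t w - Y eta nu rho BX BY n.+1 t w]%R)%E.
Proof.
move=> filtF [completeP _ _] bmX bmY indXY _ nueta rho0 rho1 /ltW t0 nux xeta n.
have [NX [mNX NX0 cX]] := bm_continuous bmX.
have [NY [mNY NY0 cY]] := bm_continuous bmY.
pose N := NX `|` NY.
have mN : measurable N by exact: measurableU.
have N0 : P N = 0 by rewrite /N measureU0.
have cX' : forall w, continuous (regularize N BX ^~ w).
  apply: continuous_regularize => w Nw; apply: contrapT => ncX.
  by apply: Nw; left; exact: cX.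
have cY' : forall w, continuous (regularize N BY ^~ w).
  apply: continuous_regularize => w Nw; apply: contrapT => ncY.
  by apply: Nw; right; exact: cY.
have aX : adapted (joint_filtration F BX BY N) (regularize N BX).
  exact: (adapted_regularizeX filtF bmX).
have aY : adapted (joint_filtration F BX BY N) (regularize N BY).
  exact: (adapted_regularizeY filtF bmY).
have Gle := joint_filtration_le filtF (BX := BX) (BY := BY) (N := N).
have Gm := joint_filtration_measurable filtF mN (BX := BX) (BY := BY).
have mE' k := measurable_process_ge Gle Gm eta nu rho cX' aX cY' aY x k t0.
have EE' k w : ~ N w ->
    [set w | x <= BX t w - Y eta nu rho BX BY k t w] w <->
    [set w | x <= regularize N BX t w
       - Y eta nu rho (regularize N BX) (regularize N BY) k t w] w.
  move=> Nw /=; rewrite (@process_ext _ _ eta nu rho BX BY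
    (regularize N BX) (regularize N BY) w t k)//.
  - by move=> u u0; rewrite regularizeE.
  - by move=> u u0; rewrite regularizeE.
have mE k : measurable [set w | x <= BX t w - Y eta nu rho BX BY k t w].
  (* The part inside [N] is measurable by completeness; outside [N] the event coincides with that of
     the regularised motions. *)
  rewrite -[X in measurable X](setUIDK _ N); apply: measurableU.
    by apply: completeP; exists N; split=> // w [].
  rewrite (_ : _ `\` N = [set w | x <= regularize N BX t w
       - Y eta nu rho (regularize N BX) (regularize N BY) k t w] `\` N).
    exact: measurableD.
  by apply/seteqP; split=> w [/[swap] Nw /(EE' k w Nw) ?].
rewrite (measure_eq_off_null mN (mE n) (mE' n) N0 (EE' n)).
rewrite (measure_eq_off_null mN (mE n.+1) (mE' n.+1) N0 (EE' n.+1)).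
apply: (probability_process_ge_le Gle Gm) => //.
move=> q u E a b y q0 qu GE.
exact: (regularize_swap filtF bmX bmY indXY mN N0).
Qed.
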